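(* Let $n\geq 1$ be an integer. The following are equivalent: (1) for every unit vector $u\in\mathbb{R}^n$, with $\pi_u$ the orthogonal projection onto the $(n-1)$-dimensional subspace $H_u$ of $\mathbb{R}^n$, there exists a vertex $\varepsilon$ of the cube $C_n$ such that $\pi_u(\varepsilon)\in H_u\cap C_n$; (2) $n\leq 9$.
   Context: $\langle\cdot,\cdot\rangle$ is the standard inner product on $\mathbb{R}^n$, and a unit vector is a vector $u$ with $\langle u,u\rangle=1$. The cube is $C_n=[-1,1]^n$; its vertices are the points of $\{-1,1\}^n$. For a unit vector $u\in\mathbb{R}^n$, $H_u=\{x\in\mathbb{R}^n:\langle x,u\rangle=0\}$, and $\pi_u$ is the orthogonal projection onto $H_u$, i.e. $\pi_u(x)=x-\langle x,u\rangle u$ for all $x\in\mathbb{R}^n$. *)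

(* Defs.v *)
From mathcomp Require Import all_boot all_order all_algebra.
From mathcomp Require Import boolp classical_sets reals.

Set Implicit Arguments.
Unset Strict Implicit.
Unset Printing Implicit Defensive.

Import Order.TTheory GRing.Theory Num.Theory.

Local Open Scope classical_set_scope.
Local Open Scope ring_scope.

(* Vectors of R^n are row vectors, over an arbitrary model R of the reals. *)
Section CubeProjection.
Variables (R : realType) (n : nat).
Implicit Types x y u : 'rV[R]_n.

Definition inner x y : R := \sum_(i < n) x 0 i * y 0 i.

Definition unit_vector u : Prop := inner u u = 1.

Definition cube : set 'rV[R]_n := [set x | forall i, -1 <= x 0 i <= 1].

Definition cube_vertices : set 'rV[R]_n :=
  [set x | forall i, x 0 i = -1 \/ x 0 i = 1].

Definition hyperplane u : set 'rV[R]_n := [set x | inner x u = 0].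

(* This is the orthogonal projection onto [hyperplane u] only when u is a unit
   vector. *)
Definition proj u x : 'rV[R]_n := x - inner x u *: u.

End CubeProjection.

Arguments cube {R n}.
Arguments cube_vertices {R n}.

(* Main.v *)
(** Multiplying by the sign [eps i], the projection of a vertex [eps] lies in the
    cube iff [0 <= eps i * (<eps, u> * u i) <= 2] for all [i].  So either
    [<eps, u> = 0], or all [eps i * u i] have the sign of [<eps, u>] and the
    condition becomes [|u|_1 * |u i| <= 2].
    For [n <= 9], [|u j| |u i| <= 2 (u j)^2 + (u i)^2 / 8] summed over the at most
    eight indices [j != i] gives this bound, so the sign vector of [u] works.
    For [n >= 10], [u = (4, 1, ..., 1, 0, ..., 0) / 5] with nine ones fails:
    [5 <eps, u>] is an odd integer, hence nonzero, while
    [|u|_1 * u 0 = 52 / 25 > 2]. *)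
Require Import Defs.
From mathcomp Require Import all_boot all_order all_algebra.
From mathcomp Require Import boolp classical_sets reals.
From mathcomp Require Import ring lra zify.

Import Order.TTheory GRing.Theory Num.Theory.

Local Open Scope classical_set_scope.
Local Open Scope ring_scope.

Lemma inner_proj (R : realType) n (u x : 'rV[R]_n) :
  unit_vector u -> inner (proj u x) u = 0.
Proof.
rewrite /unit_vector => u1; set a := inner x u.
rewrite /inner.
under eq_bigr do rewrite !mxE mulrBl -mulrA.
by rewrite sumrB -mulr_sumr -/(inner u u) u1 mulr1 subrr.
Qed.

Lemma proj_vertex_in_cube (R : realType) n (u eps : 'rV[R]_n) :
  cube_vertices eps ->
  cube (proj u eps) <->
  forall i, 0 <= eps 0 i * (inner eps u * u 0 i) <= 2.
Proof.
move=> eps_vert; rewrite /cube /=; split=> cube_u i; move: (cube_u i);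
  rewrite !mxE; case: (eps_vert i) => ->; lra.
Qed.

(** Put [a = inner eps u]. Each term [eps i * u i * a] is nonnegative, hence equal to [|a| * |u i|];
    summing over [i] gives [a ^ 2 = |a| * |u|_1], and [|a|] cancels. *)
Lemma vertex_normr_inner (R : realType) n (u eps : 'rV[R]_n) :
  cube_vertices eps -> cube (proj u eps) -> inner eps u != 0 ->
  `|inner eps u| = \sum_(i < n) `|u 0 i|.
Proof.
move=> eps_vert /(proj_vertex_in_cube _ _ u _ eps_vert) eps_cube a_neq0.
have norm_eps i : `|eps 0 i| = 1.
  by case: (eps_vert i) => ->; rewrite ?normrN normr1.
have eq_term i : eps 0 i * (inner eps u * u 0 i) = `|inner eps u| * `|u 0 i|.
  have /andP[ge0 _] := eps_cube i.
  by rewrite -(ger0_norm ge0) !normrM norm_eps mul1r.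
apply: (mulfI (x := `|inner eps u|)); first by rewrite normr_eq0.
rewrite -normrM -expr2 ger0_norm ?sqr_ge0// mulr_sumr expr2.
rewrite {2}/inner mulr_sumr; apply: eq_bigr => i _.
by rewrite -eq_term mulrCA.
Qed.

Lemma l1_norm_coord_le2 (R : realType) n (u : 'rV[R]_n) (i : 'I_n) :
  (n <= 9)%N -> unit_vector u -> (\sum_(j < n) `|u 0 j|) * `|u 0 i| <= 2.
Proof.
rewrite /unit_vector /inner => n_le9; set m := `|u 0 i|.
rewrite (bigD1 i) //= => u1; rewrite (bigD1 i) //= -/m.
have m2 : u 0 i * u 0 i = m ^+ 2 by rewrite -expr2 real_normK ?num_real.
have sum_le : (\sum_(j < n | j != i) `|u 0 j|) * m <=
    2 * (\sum_(j < n | j != i) u 0 j * u 0 j) + m ^+ 2 / 8 * (n.-1)%:R.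
  have -> : m ^+ 2 / 8 * (n.-1)%:R = \sum_(j < n | j != i) m ^+ 2 / 8.
    by rewrite sumr_const cardC1 card_ord mulr_natr.
  rewrite mulr_suml mulr_sumr -big_split /=; apply: ler_sum => j _.
  have -> : u 0 j * u 0 j = `|u 0 j| ^+ 2 by rewrite real_normK ?num_real.
  (* Twice this square is [2 * |u j| ^ 2 - |u j| * m + m ^ 2 / 8]. *)
  have := sqr_ge0 (`|u 0 j| - m / 4); nra.
have n_le : (n.-1)%:R <= 8 :> R by rewrite ler_nat; lia.
have : m ^+ 2 / 8 * (n.-1)%:R <= m ^+ 2 / 8 * 8.
  by apply: ler_wpM2l => //; rewrite divr_ge0 ?sqr_ge0.
(* The sum over [j != i] of [u j ^ 2] is [1 - m ^ 2], so the total is at most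
   [m ^ 2 + 2 * (1 - m ^ 2) + m ^ 2 = 2]. *)
nra.
Qed.

Lemma exists_vertex_proj_in_cube (R : realType) n (u : 'rV[R]_n) :
  (n <= 9)%N -> unit_vector u ->
  exists eps : 'rV[R]_n, cube_vertices eps /\ cube (proj u eps).
Proof.
move=> n_le9 u1.
pose eps : 'rV[R]_n := \row_i (if 0 <= u 0 i then 1 else -1).
have eps_vert : cube_vertices eps.
  by move=> i; rewrite mxE; case: ifP; [right | left].
have eps_u i : eps 0 i * u 0 i = `|u 0 i|.
  rewrite mxE; case: (lerP 0 (u 0 i)) => [u_ge0|u_lt0].
    by rewrite mul1r ger0_norm.
  by rewrite mulN1r ltr0_norm.
exists eps; split=> //; apply/proj_vertex_in_cube => // i.
(* For this [eps], the inner product with [u] is the l1 norm of [u]. *)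
rewrite mulrCA eps_u /inner (eq_bigr _ (fun j _ => eps_u j)).
by rewrite l1_norm_coord_le2 // mulr_ge0 ?sumr_ge0.
Qed.

(** Five times the coordinates of the counterexample, kept in [nat] so that a parity argument
    applies. *)
Definition bad_weight (i : nat) : nat :=
  if (i == 0)%N then 4%N else (i < 10)%N.

Definition bad_direction (R : realType) n : 'rV[R]_n :=
  \row_i ((bad_weight i)%:R / 5).

(** Indices from 10 on have weight 0 and drop out because [f 0 = 0]. Taking [f] to be the square
    gives 25, and the identity gives 13. *)
Lemma sum_bad_weight n (f : nat -> nat) : (10 <= n)%N -> f 0%N = 0%N ->
  (\sum_(i < n) f (bad_weight i) = f 4 + 9 * f 1)%N.
Proof.
move=> n_ge10 f0.
have -> : (\sum_(i < n) f (bad_weight i) = \sum_(i < 10) f (bad_weight i))%N.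
  rewrite (big_ord_widen n (fun i => f (bad_weight i)) n_ge10) [RHS]big_mkcond.
  apply: eq_bigr => -[i /= _] _; case: ltnP => // i_ge10.
  by rewrite /bad_weight ltnNge i_ge10; case: i i_ge10.
by rewrite !big_ord_recl big_ord0 /bad_weight /=; lia.
Qed.

Lemma bad_direction_unit (R : realType) n :
  (10 <= n)%N -> unit_vector (bad_direction R n).
Proof.
move=> n_ge10; rewrite /unit_vector /inner.
have sqr_coord (i : 'I_n) : bad_direction R n 0 i * bad_direction R n 0 i =
    (bad_weight i ^ 2)%:R / 25.
  by rewrite mxE mulf_div -!natrM mulnn.
rewrite (eq_bigr _ (fun i _ => sqr_coord i)).
rewrite -mulr_suml -natr_sum (sum_bad_weight _ (fun w => w ^ 2)%N)//.
by field.
Qed.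

Lemma bad_direction_l1 (R : realType) n :
  (10 <= n)%N -> \sum_(i < n) `|bad_direction R n 0 i| = 13 / 5.
Proof.
move=> n_ge10.
under eq_bigr do rewrite mxE ger0_norm ?divr_ge0 ?ler0n//.
by rewrite -mulr_suml -natr_sum (sum_bad_weight _ id).
Qed.

Lemma bad_direction_inner_neq0 (R : realType) n (eps : 'rV[R]_n) :
  (10 <= n)%N -> cube_vertices eps -> inner eps (bad_direction R n) != 0.
Proof.
move=> n_ge10 eps_vert; rewrite /inner.
(* [B] is the weight carried by the coordinates where [eps] is 1; the others carry [13 - B], so the
   signed total is [2 * B - 13], which is odd. *)
pose B := (\sum_(i < n) (eps 0%R i == 1%R) * bad_weight i)%N.
have -> : \sum_(i < n) eps 0 i * bad_direction R n 0 i =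
    ((2 * B)%:R - 13) / 5.
  have -> : 13 = (\sum_(i < n) bad_weight i)%:R :> R.
    by rewrite (sum_bad_weight _ id).
  rewrite /B big_distrr /= !natr_sum -sumrB.
  rewrite mulr_suml; apply: eq_bigr => i _; rewrite mxE !natrM.
  move: (bad_weight i)%:R => w.
  case: (eps_vert i) => ->; last by rewrite eqxx mulr1n; field.
  by rewrite (_ : (-1 == 1 :> R) = false) ?mulr0n; [field | apply/eqP; lra].
rewrite mulf_neq0 ?invr_neq0 ?pnatr_eq0// subr_eq0 eqr_nat.
by apply/eqP; lia.
Qed.

Lemma bad_direction_no_vertex (R : realType) n (eps : 'rV[R]_n) :
  (10 <= n)%N -> cube_vertices eps -> ~ cube (proj (bad_direction R n) eps).
Proof.
move=> n_ge10 eps_vert eps_cube.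
have a_neq0 := bad_direction_inner_neq0 _ _ _ n_ge10 eps_vert.
have := vertex_normr_inner _ _ _ _ eps_vert eps_cube a_neq0.
rewrite bad_direction_l1 //.
have n_gt0 : (0 < n)%N by apply: leq_trans n_ge10.
have := (proj_vertex_in_cube _ _ _ _ eps_vert).1 eps_cube (Ordinal n_gt0).
rewrite [bad_direction _ _ _ (Ordinal _)]mxE /bad_weight /=.
set a := inner _ _.
(* Coordinate 0 is [4 / 5] and [|a| = 13 / 5]: the product is [52 / 25 > 2] in absolute value, so it
   is too large or negative. *)
by case: (eps_vert (Ordinal n_gt0)) => ->; case: (ger0P a); lra.
Qed.

Theorem corollary1 (R : realType) (n : nat) (n_ge1 : (1 <= n)%N) :
  (forall u : 'rV[R]_n, unit_vector u ->
     exists eps : 'rV[R]_n,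
       cube_vertices eps /\ (hyperplane u `&` cube) (proj u eps))
  <-> (n <= 9)%N.
Proof.
split=> [all_u|n_le9 u u1].
  rewrite leqNgt; apply/negP => n_ge10.
  have [eps [eps_vert [_]]] := all_u _ (bad_direction_unit R n n_ge10).
  exact: bad_direction_no_vertex.
have [eps [eps_vert eps_cube]] := exists_vertex_proj_in_cube _ _ _ n_le9 u1.
by exists eps; split=> //; split=> //; exact: inner_proj.
Qed.
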